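(* Assume $2^{<\mathfrak{c}} = \mathfrak{c}$. Let $X$ be an almost discretely Lindelöf Hausdorff space such that $\psi_c(X) \cdot t(X) = \omega$. Then $|X| \leq \mathfrak{c}$.
   Context: $\mathfrak{c} = 2^{\aleph_0}$ is the cardinality of the continuum, and $2^{<\mathfrak{c}} = \sup\{2^{\lambda} : \lambda < \mathfrak{c},\ \lambda \text{ a cardinal}\}$. A space $X$ is almost discretely Lindelöf if for every discrete subset $D \subset X$ (i.e. $D$ is discrete in the subspace topology) there is a Lindelöf subspace $L$ of $X$ such that $D \subset L$. ''Lindelöf'' means that every open cover has a countable subcover. The closed pseudocharacter $\psi_c(x,X)$ of a point $x$ in $X$ is the minimum cardinal $\kappa$ such that there is a family $\{U_\alpha : \alpha < \kappa\}$ of neighbourhoods of $x$ with $\bigcap\{\overline{U_\alpha} : \alpha < \kappa\} = \{x\}$, and $\psi_c(X) = \sup\{\psi_c(x,X) : x \in X\}$. The tightness $t(x,X)$ of a point $x$ in $X$ is the minimum cardinal $\kappa$ such that for every set $A \subset X$ with $x \in \overline{A} \setminus A$ there is a set $B \subset A$ with $|B| \leq \kappa$ and $x \in \overline{B}$, and $t(X) = \sup\{t(x,X) : x \in X\}$. The hypothesis $\psi_c(X)\cdot t(X) = \omega$ says that both $\psi_c(X)$ and $t(X)$ are countable (cardinal functions are taken to have infinite values). *)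

(* Defs.v *)
From HB Require Import structures.
From mathcomp Require Import all_boot.
From mathcomp Require Import all_classical topology.

Set Implicit Arguments.
Unset Strict Implicit.
Unset Printing Implicit Defensive.

Local Open Scope classical_set_scope.
Local Open Scope card_scope.

(* A type K stands for the cardinal |K| = |[set: K]|, and a class of cardinals
   is a predicate [P : Type -> Prop]. Minima and suprema of cardinals are
   therefore relations, which determine their value up to [#=]. *)

Definition is_card_min (P : Type -> Prop) (K : Type) : Prop :=
  P K /\ forall L : Type, P L -> [set: K] #<= [set: L].

Definition is_card_sup (P : Type -> Prop) (K : Type) : Prop :=
  (forall L : Type, P L -> [set: L] #<= [set: K]) /\
  (forall M : Type, (forall L : Type, P L -> [set: L] #<= [set: M]) ->
     [set: K] #<= [set: M]).

Definition card_lt (K L : Type) : Prop :=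
  [set: K] #<= [set: L] /\ ~ ([set: L] #<= [set: K]).

Definition continuum : Type := set nat.

(* |K| = 2^{<|C|} *)
Definition is_weak_power (C K : Type) : Prop :=
  is_card_sup
    (fun M => exists2 L : Type, card_lt L C & [set: M] #= [set: set L]) K.

Definition lindelof_space (T : topologicalType) : Prop :=
  forall C : set (set T),
    (forall U, C U -> open U) -> \bigcup_(U in C) U = [set: T] ->
    exists C' : set (set T),
      [/\ C' `<=` C, countable C' & \bigcup_(U in C') U = [set: T]].

(* [set_type A] carries the topology induced by the inclusion of A. The right
   hand side is the axiom of the library's discrete topologies. *)
Definition discrete_subset (X : topologicalType) (D : set X) : Prop :=
  @nbhs (set_type D) (set_type D) = principal_filter.

Definition almost_discretely_lindelof (X : topologicalType) : Prop :=
  forall D : set X, discrete_subset D ->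
    exists2 L : set X, D `<=` L & lindelof_space (set_type L).

Definition is_closed_pseudocharacter_at (X : topologicalType) (x : X) :
    Type -> Prop :=
  is_card_min (fun K => exists2 U : K -> set X,
    (forall k, nbhs x (U k)) & \bigcap_(k in [set: K]) closure (U k) = [set x]).

Definition is_tightness_at (X : topologicalType) (x : X) : Type -> Prop :=
  is_card_min (fun K => forall A : set X, (closure A `\` A) x ->
    exists B : set X, [/\ B `<=` A, B #<= [set: K] & closure B x]).

(* Cardinal functions take infinite values only: omega is added to the set of
   cardinals whose supremum is taken. *)
Definition is_closed_pseudocharacter (X : topologicalType) : Type -> Prop :=
  is_card_sup (fun K =>
    K = nat \/ exists x : X, is_closed_pseudocharacter_at x K).

Definition is_tightness (X : topologicalType) : Type -> Prop :=
  is_card_sup (fun K => K = nat \/ exists x : X, is_tightness_at x K).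

(* Main.v *)
Require Import Defs.
From HB Require Import structures.
From mathcomp Require Import all_boot.
From mathcomp Require Import all_classical topology.
From mathcomp Require Import wochoice.

Local Open Scope classical_set_scope.
Local Open Scope card_scope.

(** The proof is a closing-off argument. Write c for the continuum and call a
    set small when its cardinality is less than c.

    König's theorem, applied to c = c ^ I with I countable or small (the latter
    because 2^{<c} = c), shows that c is regular: countable unions of small
    sets are small ([small_bigcup]), and, for a well-order of c whose proper
    initial segments are small, a small subset of c is bounded
    ([small_bounded]). Hence a set of cardinality at most c has at most c
    small subsets ([covered_small_subsets]).

    Choose for every point x countably many neighbourhoods [V x n] whose
    closures intersect in x only. With countable tightness this makes every
    point of the closure of A determined by a countable array of points of A
    ([closure_double_seq]). So c steps of closing off yield a closed set Y with
    at most c points such that, for every small family S of neighbourhoods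
    [V a n] of points a of Y, if some point of X avoids these neighbourhoods
    and the closure of their centres, then some point of Y does
    ([closing_off]).

    Then Y is all of X ([closed_off_full]). Otherwise take p outside Y and, for
    each a in Y, a neighbourhood [U a] among the [V a n] whose closure misses
    p. Let [y] enumerate Y. As p avoids the closure of any subset of Y and all
    the [U a], one can choose by recursion points [x a] of Y, for a < c, that
    avoid the closure of the set of all earlier [x b] and [y b], together with
    the neighbourhoods [U] of these points. The range of [x] is discrete, so it
    lies in a Lindelöf subspace, where c being regular and uncountable forces a
    point l all of whose neighbourhoods contain [x a] for c many indices a
    ([complete_accumulation_point]). This l is in the closure of Y, hence is
    [y b] for some b; but [x a] is outside [U (y b)] whenever a > b, so only
    a small set of indices is left, a contradiction. *)

(** * Sets smaller than the continuum, and sets of size at most the continuum *)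

Lemma card_leTP {T U : Type} (B : set U) :
  [set: T] #<= B <-> exists2 f : T -> U, injective f & forall t, B (f t).
Proof.
split=> [/card_leP[g]|[f finj fB]].
  exists (fun t => set_val (g (SigSub (mem_set (I : [set: T] t))))).
    move=> s t /val_inj /(inj (f := g)); rewrite !inE => /(_ Logic.I Logic.I).
    by move=> /(congr1 set_val).
  by move=> t; apply: set_mem; apply: valP.
have funB : set_fun [set: T] B f by [].
have finj' : {in [set: T] &, injective f} by move=> s t _ _; apply: finj.
apply: (@card_le_trans _ _ _ (f @` [set: T])).
  by have := inj_card_eq finj'; rewrite card_eq_le => /andP[].
by apply: subset_card_le => _ [t _ <-].
Qed.

Lemma card_set_type_le {T : Type} (A : set T) : [set: set_type A] #<= A.
Proof. by have := card_setT A; rewrite card_eq_le => /andP[]. Qed.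

(** Cardinals being comparable, this says that the cardinality is less than
    that of the continuum; the negative form is the one in which diagonal
    arguments use it. *)
Definition small {U : Type} (A : set U) := ~ ([set: continuum] #<= A).

(** For a nonempty type [U] this says that [A] has at most continuum many
    elements. The enumeration may leave [A], which lets [A] be empty. *)
Definition covered {U : Type} (A : set U) :=
  exists e : continuum -> U, A `<=` range e.

Lemma small_le {U V : Type} (A : set U) (B : set V) :
  A #<= B -> small B -> small A.
Proof. by move=> AB sB CA; apply: sB; apply: card_le_trans AB. Qed.

Lemma small_sub {U : Type} (A B : set U) : A `<=` B -> small B -> small A.
Proof. by move=> /subset_card_le; apply: small_le. Qed.

Lemma small_image {U V : Type} (f : U -> V) (A : set U) :
  small A -> small (f @` A).
Proof. exact: small_le (card_image_le f A). Qed.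

Lemma coveredS {U : Type} (A B : set U) : A `<=` B -> covered B -> covered A.
Proof. by move=> AB [e Be]; exists e; apply: subset_trans Be. Qed.

Lemma covered_image {U V : Type} (f : U -> V) (A : set U) :
  covered A -> covered (f @` A).
Proof.
by move=> [e Ae]; exists (f \o e) => _ [u /Ae[c _ <-] <-]; exists c.
Qed.

Lemma covered_le {U : Type} (A : set U) : covered A -> A #<= [set: continuum].
Proof.
move=> [e Ae]; apply: card_le_trans (card_image_le e _).
exact: subset_card_le.
Qed.

Lemma le_covered {U : Type} (u0 : U) (A : set U) :
  A #<= [set: continuum] -> covered A.
Proof.
move=> /pcard_injP[f finj].
exists (fun c => if pselect (exists2 u, A u & f u = c) is left h
                 then projT1 (cid2 h) else u0) => u Au.
exists (f u) => //; case: pselect => [h|[]]; last by exists u.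
by case: (cid2 h) => v Av /= /finj; rewrite !inE; apply.
Qed.

Lemma covered_continuum : covered [set: continuum].
Proof. by exists id => c _; exists c. Qed.

(** König's diagonal argument. For each index [i] the map sending [c] to the
    [i]-th coordinate of the function coded by [c] cannot send [F i] onto the
    continuum; a function whose [i]-th coordinate is a value missed by [F i]
    has its code outside every [F i]. *)
Lemma konig (I : Type) (F : I -> set continuum) :
  covered [set: I -> continuum] -> (forall i, small (F i)) ->
  exists c, forall i, ~ F i c.
Proof.
move=> [e esurj] sF.
have /choice[d dP] i : exists x, forall c, F i c -> e c i <> x.
  apply: contrapT => /forallNP h; apply: (sF i).
  have /choice[s sP] x : exists c, F i c /\ e c i = x.
    have /existsNP[c] := h x; rewrite not_implyE => -[Fc /contrapT ec].
    by exists c.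
  apply/card_leTP; exists s => [x y sxy|x]; last by case: (sP x).
  by case: (sP x) => _ <-; case: (sP y) => _ <-; rewrite sxy.
have [c _ ec] := esurj d Logic.I.
by exists c => i /dP; rewrite ec.
Qed.

(** Exponent law: functions from [I] to [set nat] are subsets of
    [I * nat]. *)
Lemma covered_fun_set (I : Type) :
  [set: set (I * nat)] #<= [set: continuum] -> covered [set: I -> continuum].
Proof.
move=> /(le_covered set0)[e esurj].
exists (fun c i => [set m | e c (i, m)]) => g _.
have [c _ ec] := esurj [set p | g p.1 p.2] Logic.I.
by exists c => //; rewrite ec.
Qed.

Lemma covered_seq : covered [set: nat -> continuum].
Proof.
apply: covered_fun_set; apply/card_leTP.
exists (fun s => pickle @` s) => // s t st.
have pinj : injective (@pickle (nat * nat)%type) by apply: pcan_inj pickleK.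
by apply/seteqP; split=> p ps;
  [have : (pickle @` t) (pickle p) by rewrite -st; exists p
  |have : (pickle @` s) (pickle p) by rewrite st; exists p];
  case=> q qs /pinj <-.
Qed.

Lemma covered_seq2 : covered [set: nat -> nat -> continuum].
Proof.
have [e esurj] := covered_seq; exists (fun c n => e (e c n)) => b _.
have /choice[d dP] n : exists c, e c = b n.
  by have [c _ ec] := esurj (b n) Logic.I; exists c.
have [c _ ec] := esurj d Logic.I.
by exists c => //; apply/funext => n; rewrite ec dP.
Qed.

Lemma covered_setX {U V : Type} (A : set U) (B : set V) :
  covered A -> covered B -> covered (A `*` B).
Proof.
move=> [f Af] [g Bg]; have [e esurj] := covered_seq.
exists (fun c => (f (e c 0), g (e c 1))) => -[u v] [/= /Af[c _ <-] /Bg[d _ <-]].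
have [x _ ex] := esurj (fun n => if n is 0 then c else d) Logic.I.
by exists x => //; rewrite ex.
Qed.

Lemma covered_nat : covered [set: nat].
Proof.
exists (fun c => xget 0%N c) => n _; exists [set n] => //.
exact: (@xgetPex _ 0 [set n]) (ex_intro _ n erefl).
Qed.

Lemma covered_bigcup {U I : Type} (u0 : U) (D : set I) (F : I -> set U) :
  covered D -> (forall i, D i -> covered (F i)) ->
  covered (\bigcup_(i in D) F i).
Proof.
move=> covD covF.
have /choice[e eP] i : exists e : continuum -> U, D i -> F i `<=` range e.
  have [/covF[e Fe]|nD] := pselect (D i); first by exists e.
  by exists (fun=> u0).
have := covered_setX _ _ covD covered_continuum.
move=> /(covered_image (fun p => e p.1 p.2)); apply: coveredS => u [i Di Fu].
by have [c _ <-] := eP i Di u Fu; exists (i, c).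
Qed.

Lemma covered_setU {U : Type} (A B : set U) :
  covered A -> covered B -> covered (A `|` B).
Proof.
move=> cA cB; have [e Ae] := cA; rewrite -bigcup2E.
apply: covered_bigcup covered_nat _; first exact: (e set0).
move=> [|[|n]] _ //=; by exists e.
Qed.

(** The continuum has uncountable cofinality, by [konig] and
    c = c ^ aleph_0. *)
Lemma small_bigcup {U : Type} (F : nat -> set U) :
  (forall n, small (F n)) -> small (\bigcup_n F n).
Proof.
move=> sF /card_leTP[f finj fF].
have [n|c cF] := konig nat (fun n => f @^-1` F n) covered_seq.
  by apply: small_le (sF n); apply: card_ge_preimage; move=> ? ? _ _; apply: finj.
by have [n _ Fn] := fF c; apply: (cF n).
Qed.

Lemma small0 {U : Type} : small (@set0 U).
Proof. by move=> /card_leTP[f _ /(_ set0)]. Qed.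

Lemma small1 {U : Type} (u : U) : small [set u].
Proof.
move=> /card_leTP[f finj fu].
have /finj : f set0 = f setT by rewrite !fu.
by move=> e; have : @set0 nat 0 by rewrite e.
Qed.

Lemma smallU {U : Type} (A B : set U) : small A -> small B -> small (A `|` B).
Proof.
move=> sA sB; rewrite -bigcup2E; apply: small_bigcup => -[|[|n]] //=.
exact: small0.
Qed.

Lemma small_countable {U : Type} (A : set U) : countable A -> small A.
Proof.
move=> /small_le; apply.
have -> : [set: nat] = \bigcup_n [set n].
  by apply/seteqP; split=> n // _; exists n.
by apply: small_bigcup => n; apply: small1.
Qed.

Lemma range_enum {T : Type} (A : set T) : countable A -> A !=set0 ->
  exists b : nat -> T, range b = A.
Proof.
move=> /countable_injP[f finj] [a0 Aa0].
have /choice[b bP] n :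
    exists a, A a /\ forall a', A a' -> f a' = n -> a = a'.
  have [[a Aa fa]|h] := pselect (exists2 a, A a & f a = n).
    by exists a; split=> // a' Aa' fa'; apply: finj; rewrite ?inE // fa fa'.
  by exists a0; split=> // a' Aa' fa'; case: h; exists a'.
exists b; apply/seteqP; split=> [_ [n _ <-]|a Aa]; first by case: (bP n).
by exists (f a) => //; case: (bP (f a)) => _; apply.
Qed.

Lemma small_bigcup_countable {U I : Type} (D : set I) (F : I -> set U) :
  countable D -> (forall i, D i -> small (F i)) -> small (\bigcup_(i in D) F i).
Proof.
move=> cD sF; have [->|D0] := eqVneq D set0.
  by rewrite bigcup_set0; apply: small0.
have [b bD] := range_enum _ cD ((set0P _).1 D0).
rewrite -bD bigcup_image; apply: small_bigcup => n.
by apply: sF; rewrite -bD; exists n.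
Qed.

(** * Well-orders *)

Lemma exists_wellorder (T : eqType) : exists lt : T -> T -> Prop,
  well_founded lt /\ forall x y, [\/ lt x y, x = y | lt y x].
Proof.
have [R wR] := well_ordering_principle T.
exists (fun x y => ~~ R y x); split.
  move=> x; apply: contrapT => nx.
  have [|z [[/asboolP nz zmin] _]] :=
      wR [pred y | `[< ~ Acc (fun x y => ~~ R y x) y >]].
    by exists x; apply/asboolP.
  apply: nz; constructor=> y nRzy; apply: contrapT => nAy.
  by move/negP: nRzy; apply; apply: zmin; apply/asboolP.
move=> x y; have [Ryx|] := boolP (R y x); last by constructor 1.
have [Rxy|] := boolP (R x y); last by constructor 3.
(* [x] and [y] are both least in [{x, y}], whose least element is unique. *)
constructor 2; have [|z [_ zu]] := wR [pred t | (t == x) || (t == y)].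
  by exists x; rewrite inE eqxx.
have Rrefl t : R t t.
  have [|u [[/eqP ut umin] _]] := wR (pred1 t); first by exists t; rewrite inE.
  by rewrite -{1}ut; apply: umin; rewrite inE.
have <- : z = x.
  by apply: zu; split=> [|t]; rewrite ?inE ?eqxx // => /orP[] /eqP->.
by apply: zu; split=> [|t]; rewrite ?inE ?eqxx ?orbT // => /orP[] /eqP->.
Qed.

(** If some initial segment of a well-order of the continuum is not small,
    the continuum injects into the least such segment, and pulling the order
    back along the injection makes all segments small. *)
Lemma continuum_initial_order : exists lt : continuum -> continuum -> Prop,
  [/\ well_founded lt, forall x y, [\/ lt x y, x = y | lt y x]
    & forall a, small [set x | lt x a]].
Proof.
have [lt [ltwf lttri]] := exists_wellorder (set nat : eqType).
have [sm|/existsNP[a0 na0]] := pselect (forall a, small [set x | lt x a]).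
  by exists lt.
have [a [nsma amin]] : exists a, ~ small [set x | lt x a] /\
    forall b, lt b a -> small [set x | lt x b].
  elim: (ltwf a0) na0 => a _ IH nsa.
  have [sm|/existsNP[b]] :=
      pselect (forall b, lt b a -> small [set x | lt x b]).
    by exists a.
  by rewrite not_implyE => -[/IH]; apply.
move/contrapT/card_leTP: nsma => [f finj fa].
exists (fun x y => lt (f x) (f y)); split.
- move=> x; have [y yx] : exists y, f x = y by exists (f x).
  elim: (ltwf y) x yx => {}y _ IH x yx; constructor=> z.
  by rewrite yx => /IH; apply.
- move=> x y; have [h|/finj h|h] := lttri (f x) (f y).
  + by constructor 1.
  + by constructor 2.
  + by constructor 3.
- move=> x /card_leTP[g ginj gx]; apply: (amin (f x) (fa x)).
  by apply/card_leTP; exists (f \o g) => //; apply: inj_comp.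
Qed.

Lemma wf_recursion (I T : Type) (lt : I -> I -> Prop) (F : I -> set T -> T) :
  well_founded lt ->
  exists f : I -> T, forall a, f a = F a (f @` [set b | lt b a]).
Proof.
move=> wf.
pose G a (rec : forall b, lt b a -> T) :=
  F a [set t | exists b (h : lt b a), rec b h = t].
exists (Fix wf (fun=> T) G) => a; rewrite Fix_eq.
  congr (F a _); apply/seteqP; split=> t; first by move=> [b [h <-]]; exists b.
  by move=> [b h <-]; exists b, h.
move=> x f g fg; congr (F x _).
by apply/seteqP; split=> t [b [h <-]]; exists b, h; rewrite fg.
Qed.

(** * Minima of classes of cardinals *)

(** Take a maximal set [F] of elements of the product of the [A i] among those
    on which every projection is injective. Some projection maps [F] onto its
    factor [A i], since otherwise a choice of missed coordinates could be added
    to [F]; following the inverse of this projection by the projection to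
    [A j] injects [A i] into [A j]. *)
Lemma card_le_min (I : Type) (A : I -> Type) : I ->
  exists i, forall j, [set: A i] #<= [set: A j].
Proof.
move=> i0.
pose P := forall i, A i.
pose ok (F : set P) := forall f g i, F f -> F g -> f i = g i -> f = g.
have [|F [okF Fmax]] := @Zorn_bigcup P ok.
  move=> G Gok Gtot f g i [Ff GF Fff] [Fg GG Fgg].
  have [/(_ f Fff) h|/(_ g Fgg) h] := Gtot _ _ GF GG.
  - exact: (Gok _ GG).
  - exact: (Gok _ GF).
have [[i Fi]|] := pselect (exists i, forall a : A i, exists2 f, F f & f i = a).
  exists i => j; have /choice[s sP] a : exists f, F f /\ f i = a.
    by have [f] := Fi a; exists f.
  apply/card_leTP; exists (fun a => s a j) => // a b ab.
  case: (sP a) => Fa <-; case: (sP b) => Fb <-.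
  by rewrite (okF _ _ _ Fa Fb ab).
move=> /forallNP noF; exfalso.
have miss i : exists a : A i, forall f, F f -> f i <> a.
  have /existsNP[a na] := noF i.
  by exists a => f Ff fa; apply: na; exists f.
pose h i := projT1 (cid (miss i)).
have hP i f : F f -> f i <> h i.
  by rewrite /h; case: cid => a /= aP; apply: aP.
have Fh : ~ F h by move=> /(hP i0); apply.
apply: (Fmax (F `|` [set h])).
  split=> [|sub]; first by move=> f; left.
  by apply: Fh; apply: sub; right.
move=> f g i [Ff|->] [Fg|->] //; first exact: okF Ff Fg.
- by move=> /(hP _ _ Ff).
- by move=> /esym /(hP _ _ Fg).
Qed.

Lemma card_le_total (T U : Type) :
  [set: T] #<= [set: U] \/ [set: U] #<= [set: T].
Proof.
have [[] h] := card_le_min bool (fun b => if b then T else U) true.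
- by left; have := h false.
- by right; have := h true.
Qed.

(** The family of all types satisfying [P] is replaced by that of the subsets
    of [K0] satisfying [P]: the other types are comparable with [K0], hence
    larger or equipotent to such a subset. *)
Lemma card_min_exists (P : Type -> Prop) (K0 : Type) :
  (forall K L : Type, P K -> [set: K] #<= [set: L] -> P L) -> P K0 ->
  exists K, is_card_min P K.
Proof.
move=> Pup PK0.
have sub_all (A : set K0) : [set: set_type A] #<= [set: K0].
  by apply/card_leTP; exists set_val => //; apply: val_inj.
pose I := {A : set K0 | P (set_type A)}.
have PT : P (set_type [set: K0]).
  apply: Pup PK0 _; apply/card_leTP.
  exists (fun k => SigSub (mem_set (Logic.I : [set: K0] k))) => // k l.
  by move=> /(congr1 set_val).
have [[A PA] Amin] :=
  card_le_min I (fun i => set_type (projT1 i)) (exist _ _ PT).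
exists (set_type A); split=> // L PL.
have [//|LA] := card_le_total (set_type A) L.
have /card_leTP[f finj _] := card_le_trans LA (sub_all A).
have fL l : range f (f l) by exists l.
have rL : [set: L] #<= [set: set_type (range f)].
  apply/card_leTP; exists (fun l => SigSub (mem_set (fL l))) => //.
  by move=> l m /(congr1 set_val) /finj.
apply: card_le_trans (Amin (exist _ (range f) (Pup _ _ PL rL))) _ => /=.
by apply: card_le_trans (card_set_type_le _) (card_image_le f _).
Qed.

(** * Regularity of the continuum *)

Lemma small_power (L : Type) : is_weak_power continuum continuum ->
  [set: L] #<= [set: continuum] -> small [set: L] ->
  [set: set L] #<= [set: continuum].
Proof. by move=> [wp _] Lc sL; apply: wp; exists L => //; apply: card_eqxx. Qed.

Lemma covered_fun (L : Type) : is_weak_power continuum continuum ->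
  [set: L] #<= [set: continuum] -> small [set: L] ->
  covered [set: L -> continuum].
Proof.
move=> wp Lc sL; apply: covered_fun_set; apply: small_power => //.
  have /card_leTP[f finj _] := Lc.
  have cov := covered_setX _ _ covered_continuum covered_nat.
  apply: card_le_trans (covered_le _ cov); apply/card_leTP.
  by exists (fun p => (f p.1, p.2)) => // -[l m] [l' m'] [/finj -> ->].
suff -> : [set: L * nat] = \bigcup_n [set p | p.2 = n].
  apply: small_bigcup => n.
  apply: small_sub (small_image (fun l => (l, n)) _ sL).
  by move=> [l m] /= ->; exists l.
by apply/seteqP; split=> // -[l n] _; exists n.
Qed.

Section InitialOrder.
Variable (lt : continuum -> continuum -> Prop).
Hypothesis wp : is_weak_power continuum continuum.
Hypothesis lttri : forall x y, [\/ lt x y, x = y | lt y x].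
Hypothesis ltsmall : forall a, small [set x | lt x a].

(** By [konig] with the index set [S], the closed initial segments ending in
    [S] do not exhaust the continuum. *)
Lemma small_bounded (S : set continuum) :
  small S -> exists a, S `<=` [set x | lt x a].
Proof.
move=> sS.
have cS : covered [set: set_type S -> continuum].
  apply: covered_fun => //.
    exact: card_le_trans (card_set_type_le S) (card_leT S).
  exact: small_le (card_set_type_le S) sS.
have [t|a aP] := konig (set_type S)
    (fun t => [set x | lt x (val t)] `|` [set val t]) cS.
  by apply: smallU; [apply: ltsmall | apply: small1].
exists a => s Ss /=; have := aP (SigSub (mem_set Ss)).
by have [//|sa|sa] := lttri s a; case; [right|left].
Qed.

(** By [small_bounded] every small set of indices is contained in one of the
    continuum many proper initial segments, and each of these, being small,
    has at most continuum many subsets. *)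
Lemma covered_small : covered [set S : set continuum | small S].
Proof.
have [e eP] : covered (\bigcup_(a in [set: continuum])
    [set S | S `<=` [set x | lt x a]]).
  apply: covered_bigcup covered_continuum _; first exact: set0.
  move=> a _; have le := card_set_type_le [set x | lt x a].
  have : covered [set: set (set_type [set x | lt x a])].
    apply: le_covered; first exact: set0.
    apply: small_power => //; last exact: small_le le (ltsmall a).
    exact: card_le_trans le (card_leT _).
  move=> /(covered_image (fun S => set_val @` S)); apply: coveredS => S Sa.
  exists (set_val @^-1` S) => //.
  apply/seteqP; split=> [_ [x Sx <-]//|x Sx].
  by exists (SigSub (mem_set (Sa x Sx))).
by exists e => S /small_bounded[a Sa]; apply: eP; exists a.
Qed.

Lemma covered_small_subsets {U : Type} (A : set U) :
  covered A -> covered [set S | S `<=` A /\ small S].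
Proof.
move=> [e Ae]; have := covered_image (fun T => e @` T) _ covered_small.
apply: coveredS => S [SA sS].
have /choice[s sP] u : exists c, A u -> e c = u.
  have [/Ae[c _ ec]|nA] := pselect (A u); first by exists c.
  by exists set0.
exists (s @` S) => /=; first exact: small_image.
apply/seteqP; split=> [_ [_ [u Su <-] <-]|u Su].
  by rewrite sP//; apply: SA.
by exists (s u); [exists u|apply: sP; apply: SA].
Qed.

End InitialOrder.

(** * Countable tightness and countable closed pseudocharacter *)

Definition countably_tight (X : topologicalType) := forall (A : set X) (x : X),
  closure A x -> exists B, [/\ B `<=` A, countable B & closure B x].

(** The supremum only bounds those local minima that exist, so the minimum at
    [x] has to be produced first ([card_min_exists]); this is also where the
    Hausdorff property matters, as it provides some family with the required
    intersection. *)
Lemma countable_closed_pseudocharacter_family (X : topologicalType)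
    (K : Type) :
  is_closed_pseudocharacter X K -> hausdorff_space X ->
  [set: K] #<= [set: nat] ->
  exists V : X -> nat -> set X, (forall x n, nbhs x (V x n)) /\
    forall x, \bigcap_n closure (V x n) = [set x].
Proof.
move=> [Ksup _] hX Knat.
have /choice[V VP] x : exists V : nat -> set X, (forall n, nbhs x (V n)) /\
    \bigcap_n closure (V n) = [set x].
  pose P K := exists2 U : K -> set X,
    (forall k, nbhs x (U k)) &
    \bigcap_(k in [set: K]) closure (U k) = [set x].
  have Pup K1 L : P K1 -> [set: K1] #<= [set: L] -> P L.
    move=> [U Ux Ucap] /card_leTP[f finj _].
    (* [W l] is the whole space when [l] is outside the range of [f]. *)
    pose W l := [set y | forall k, f k = l -> U k y].
    have Wx l : nbhs x (W l).
      have [[k fk]|h] := pselect (exists k, f k = l).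
        by apply: filterS (Ux k) => y Uy k' fk'; rewrite (finj k' k)// fk' fk.
      by apply: filterS filterT => y _ k fk; case: h; exists k.
    exists W => //; apply/seteqP; split=> [y yW|_ -> l _]; last first.
      by apply: subset_closure; apply: nbhs_singleton.
    rewrite -Ucap => k _.
    by apply: closureS (yW (f k) Logic.I) => z; exact.
  have P0 : P {W : set X | nbhs x W}.
    exists (fun W => projT1 W) => [[W Wx]//|].
    apply/seteqP; split=> [y yW|_ -> [W Wx] _]; last first.
      by apply: subset_closure; apply: nbhs_singleton.
    apply/esym; apply: hX => A B Ax By.
    by have := yW (exist _ A Ax) Logic.I B By.
  have [K1 K1min] := card_min_exists P _ Pup P0.
  have K1K : [set: K1] #<= [set: K] by apply: Ksup; right; exists x.
  have [U Ux Ucap] := Pup _ _ K1min.1 (card_le_trans K1K Knat).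
  by exists U.
by exists V; split=> x; case: (VP x).
Qed.

Lemma countable_tightness (X : topologicalType) (K : Type) :
  is_tightness X K -> [set: K] #<= [set: nat] -> countably_tight X.
Proof.
move=> [Ksup _] Knat A x clA.
have [Ax|nAx] := pselect (A x).
  exists [set x]; split=> [_ ->//||]; last exact: subset_closure.
  by apply: finite_set_countable; apply: finite_set1.
pose P K := forall A : set X, (closure A `\` A) x ->
      exists B : set X, [/\ B `<=` A, B #<= [set: K] & closure B x].
have [K1 K1min] : exists K1, is_card_min P K1.
  apply: (card_min_exists _ X) => [K1 L PK1 KL A' /PK1[B [BA BK clB]]|].
    by exists B; split=> //; apply: card_le_trans KL.
  by move=> A' [clA' _]; exists A'; split=> //; apply: card_leT.
have K1K : [set: K1] #<= [set: K] by apply: Ksup; right; exists x.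
have [B [BA BK clB]] := K1min.1 A (conj clA nAx).
by exists B; split=> //; apply: card_le_trans BK (card_le_trans K1K Knat).
Qed.

(** For a countable [B] in [A] with [x] in its closure, [b n] enumerates the
    intersection of [B] with [V x n]: its closure contains [x] and lies in the
    closure of [V x n]. *)
Lemma closure_double_seq {X : topologicalType} {V : X -> nat -> set X} :
  (forall x n, nbhs x (V x n)) ->
  (forall x, \bigcap_n closure (V x n) = [set x]) ->
  countably_tight X ->
  forall (A : set X) x, closure A x -> exists b : nat -> nat -> X,
    (forall n m, A (b n m)) /\ \bigcap_n closure (range (b n)) = [set x].
Proof.
move=> Vx Vcap tight A x /tight[B [BA cB clB]].
have /choice[b bE] n : exists b : nat -> X, range b = B `&` V x n.
  apply: range_enum; last exact: clB.
  by apply: sub_countable cB; apply: subset_card_le.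
have bV n m : (B `&` V x n) (b n m) by rewrite -bE; exists m.
exists b; split=> [n m|]; first by apply: BA; case: (bV n m).
apply/seteqP; split=> [y by_|_ -> n _ W Wx].
  rewrite -Vcap => n _; apply: (closureS _ (by_ n Logic.I)).
  by move=> _ [m _ <-]; case: (bV n m).
by rewrite bE -setIA; apply: clB; apply: filterI.
Qed.

(** * Closing off *)

(** [S] lists neighbourhoods, the pair [(a, n)] standing for [V a n]; the
    centres are the first components. *)
Definition escapes {X : topologicalType} (V : X -> nat -> set X)
    (S : set (X * nat)) (q : X) :=
  ~ closure (fst @` S) q /\ forall a n, S (a, n) -> ~ V a n q.

Section ClosingOff.
Context {X : topologicalType} (x0 : X) (V : X -> nat -> set X).
Hypothesis wp : is_weak_power continuum continuum.
Hypothesis Vx : forall x n, nbhs x (V x n).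
Hypothesis Vcap : forall x, \bigcap_n closure (V x n) = [set x].
Hypothesis tight : countably_tight X.

(* The point that [closure_double_seq] associates with an array. *)
Let limit (b : nat -> nat -> X) : X :=
  xget x0 [set x | \bigcap_n closure (range (b n)) = [set x]].

Let stage (A : set X) : set X :=
  limit @` [set b | forall n m, A (b n m)] `|`
  [set xget x0 (escapes V S) | S in [set S | S `<=` A `*` setT /\ small S]].

(** Iterate [stage] along an initial well-order of the continuum and take the
    union of the stages. Each has at most continuum many points, and since
    small sets of indices are bounded, a small part of the union is contained
    in the union of the stages before some [a], so that [stage] has been
    applied to it. *)
Lemma closing_off : exists Y : set X, [/\ covered Y, closed Y &
  forall S, S `<=` Y `*` setT -> small S ->
    (exists p, escapes V S p) -> exists2 q, Y q & escapes V S q].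
Proof.
have [lt [ltwf lttri ltsmall]] := continuum_initial_order.
have [Z ZE] :=
  wf_recursion _ _ _ (fun _ F => stage (\bigcup_(A in F) A)) ltwf.
have covZ a : covered (Z a).
  elim: (ltwf a) => {}a _ IH; rewrite ZE.
  have : covered (\bigcup_(A in Z @` [set b | lt b a]) A).
    rewrite bigcup_image; apply: covered_bigcup => //.
    exact: coveredS covered_continuum.
  move: (\bigcup_(_ in _) _) => A covA.
  apply: covered_setU; apply: covered_image.
    have [e Ae] := covA; have [d dsurj] := covered_seq2.
    exists (fun c n m => e (d c n m)) => b bA.
    have /choice[g gP] nm : exists c, e c = b nm.1 nm.2.
      by have [c _ <-] := Ae _ (bA nm.1 nm.2); exists c.
    have [c _ dc] := dsurj (fun n m => g (n, m)) Logic.I.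
    by exists c => //; apply/funext => n; apply/funext => m; rewrite dc gP.
  apply: (covered_small_subsets _ wp lttri ltsmall).
  exact: covered_setX covered_nat.
pose Y := \bigcup_(a in [set: continuum]) Z a.
have YZ (T : Type) (S : set T) (f : T -> X) :
    small S -> (forall t, S t -> Y (f t)) ->
    exists a, forall t, S t -> (\bigcup_(A in Z @` [set b | lt b a]) A) (f t).
  move=> sS SY; have /choice[r rP] t : exists a, S t -> Z a (f t).
    by have [/SY[a _ Za]|nS] := pselect (S t); [exists a|exists set0].
  have [a aP] :=
    small_bounded _ wp lttri ltsmall _ (small_image r _ sS).
  exists a => t St; exists (Z (r t)); last exact: rP.
  by exists (r t) => //; apply: aP; exists t.
exists Y; split.
- exact: covered_bigcup covered_continuum _.
- move=> x /(closure_double_seq Vx Vcap tight)[b [bY bx]].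
  have sT : small [set: nat * nat] by apply: small_countable.
  have [|a aP] := YZ _ _ (fun p => b p.1 p.2) sT; first by [].
  exists a => //; rewrite ZE; left; exists b => [n m|].
    exact: (aP (n, m)).
  rewrite /limit.
  have := @xgetPex _ x0 [set x | \bigcap_n closure (range (b n)) = [set x]].
  move=> /(_ (ex_intro _ x bx)); move: (xget _ _) => y /=.
  by rewrite bx => /seteqP[_ /(_ y erefl)].
- move=> S SY sS ex; have [|a aP] := YZ _ S fst sS; first by move=> t /SY[].
  exists (xget x0 (escapes V S)); last exact: xgetPex.
  exists a => //; rewrite ZE; right; exists S => //; split=> // t St.
  by split=> //; apply: aP.
Qed.

End ClosingOff.

(** * Discrete subsets and complete accumulation points *)

Lemma discrete_subset_isolated {X : topologicalType} (D : set X) :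
  (forall x, D x -> exists2 W, nbhs x W & W `&` D `<=` [set x]) ->
  discrete_subset D.
Proof.
move=> iso; apply/predeq2P => x A; rewrite principal_filterP; split.
  exact: nbhs_singleton.
move=> Ax; have [W Wx WD] := iso _ (set_mem (valP x)).
have := @initial_continuous (set_type D) X set_val x _ Wx.
rewrite nbhs_simpl /=; apply: filterS => y Wy.
have /val_inj -> // : val y = val x.
by apply: WD; split=> //; apply: set_mem (valP y).
Qed.

(** Otherwise the open sets meeting the family [x] in a small set of indices
    cover [L]; countably many of them do, and the set of all indices would be
    a countable union of small sets. *)
Lemma complete_accumulation_point {X : topologicalType} (L : set X)
    (x : continuum -> X) :
  lindelof_space (set_type L) -> (forall a, L (x a)) ->
  exists2 l, L l & forall W, open W -> W l -> ~ small (x @^-1` W).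
Proof.
move=> Llind Lx; apply: contrapT => noacc.
pose F (O : set (set_type L)) := [set a | exists2 l, O l & val l = x a].
have [||C' [C'C cC' C'T]] := Llind [set O | open O /\ small (F O)].
- by move=> O [].
- apply/seteqP; split=> // l _.
  have [W [oW Wl sW]] : exists W, [/\ open W, W (val l) & small (x @^-1` W)].
    apply: contrapT => noW; apply: noacc.
    exists (val l); first exact: set_mem (valP l).
    by move=> W oW Wl sW; apply: noW; exists W.
  exists (val @^-1` W) => //; split; first by exists W.
  by apply: small_sub sW => a /= [l' + <-].
suff : small [set: continuum] by apply; apply: card_lexx.
have sF : small (\bigcup_(O in C') F O).
  by apply: small_bigcup_countable => // O /C'C[].
apply: small_sub sF => a _.
have : [set: set_type L] (SigSub (mem_set (Lx a))) by [].
by rewrite -C'T => -[O CO Ol]; exists O => //; exists (SigSub (mem_set (Lx a))).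
Qed.

(** The recursion avoids the earlier points of the family [x] to make its range
    discrete. It avoids the earlier points of an enumeration [y] of [Y] so that
    each point of [Y] has a neighbourhood containing [x a] for a small set of
    indices [a] only; as [Y] is closed, no complete accumulation point of the
    family is then left in the closure of its range. *)
Lemma closed_off_full {X : topologicalType} (V : X -> nat -> set X)
    (Y : set X) :
  almost_discretely_lindelof X ->
  (forall x n, nbhs x (V x n)) ->
  (forall x, \bigcap_n closure (V x n) = [set x]) ->
  covered Y -> closed Y ->
  (forall S, S `<=` Y `*` setT -> small S ->
    (exists p, escapes V S p) -> exists2 q, Y q & escapes V S q) ->
  Y = setT.
Proof.
move=> adL Vx Vcap [y Yy] Yclosed Yesc.
apply: contrapT => YT; have [p nYp] : exists p, ~ Y p.
  by apply/existsNP => h; apply: YT; apply/seteqP; split.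
have /choice[n nP] a : exists n, Y a -> ~ closure (V a n) p.
  have [Ya|nYa] := pselect (Y a); last by exists 0.
  have : ~ (\bigcap_n closure (V a n)) p.
    by rewrite Vcap => pa; apply: nYp; rewrite pa.
  rewrite -[X in ~ X]/(forall n, setT n -> _) => /existsNP[n].
  by rewrite not_implyE => -[_ h]; exists n.
pose U a := V a (n a).
have Ux a : nbhs a (U a) by apply: Vx.
have [lt [ltwf lttri ltsmall]] := continuum_initial_order.
(* The intersection with [Y] lets the closing-off property [Yesc] apply at
   every step without an induction showing that the points chosen so far are
   in [Y]. *)
pose past a E := Y `&` (E `|` y @` [set b | lt b a]).
have [x xE] := wf_recursion _ _ _ (fun a E =>
  xget p [set q | Y q /\ escapes V [set (a, n a) | a in past a E] q]) ltwf.
pose A a := past a (x @` [set b | lt b a]).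
have xP a :
    [/\ Y (x a), ~ closure (A a) (x a) & forall z, A a z -> ~ U z (x a)].
  set S := [set (z, n z) | z in A a].
  have fstS : fst @` S = A a by rewrite image_comp; exact: image_id.
  have Sesc q : escapes V S q <->
      ~ closure (A a) q /\ forall z, A a z -> ~ U z q.
    rewrite /escapes fstS; split=> -[ncl nU]; split=> //.
      by move=> z Az; apply: nU; exists z.
    by move=> z m [z' Az [<- <-]]; apply: nU.
  have [||| q Yq escq] := Yesc S.
  - by move=> _ [z [Yz _] <-].
  - apply: small_image; apply: small_sub (@subIsetr _ _ _) _.
    by apply: smallU; apply: small_image.
  - exists p; apply/Sesc; split=> [clp|z [Yz _] Up].
      by apply/nYp/Yclosed/(closureS _ clp) => z [].
    by apply: (nP z Yz); apply: subset_closure.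
  have := @xgetPex _ p _
    (ex_intro (fun q => Y q /\ escapes V S q) q (conj Yq escq)).
  by rewrite -xE => -[Yx /Sesc[]].
have xlt a b : lt b a -> A a (x b).
  by move=> ba; split; [case: (xP b)|left; exists b].
have dD : discrete_subset (range x).
  apply: discrete_subset_isolated => _ [a _ <-].
  exists (U (x a) `&` ~` closure (A a)).
    apply: filterI => //; apply: open_nbhs_nbhs; split; last by case: (xP a).
    exact/closed_openC/closed_closure.
  move=> z [[Uz ncl] [b _ eb]]; rewrite -eb in Uz ncl *.
  have [ab|->//|ba] := lttri a b.
    by case: (xP b) => _ _ /(_ _ (xlt _ _ ab)).
  by exfalso; apply: ncl; apply: subset_closure; apply: xlt.
have [L DL Llind] := adL _ dD.
have [|l Ll lacc] := complete_accumulation_point L x Llind.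
  by move=> a; apply: DL; exists a.
have lD : closure (range x) l.
  apply: contrapT => nlD; apply: (lacc (~` closure (range x))) => //.
    exact/closed_openC/closed_closure.
  suff -> : x @^-1` (~` closure (range x)) = set0 by apply: small0.
  apply/seteqP; split=> // a /=; apply; apply: subset_closure.
  by exists a.
have Yl : Y l.
  by apply: Yclosed; apply: closureS lD => _ [a _ <-]; case: (xP a).
have [c _ cl] := Yy _ Yl.
apply: (lacc (U l)°); [exact: open_interior|exact: Ux|].
apply: small_sub (smallU _ _ (ltsmall c) (small1 c)) => a /= Ua.
have [|->|ca] := lttri a c; [by left|by right|].
case: (xP a) => _ _ /(_ l); case.
  by split=> //; right; exists c.
exact: interior_subset.
Qed.

(** * The cardinality bound *)

Theorem theorem9 (weak_power_continuum : is_weak_power continuum continuum)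
  (X : topologicalType) (kappa lambda : Type) :
  almost_discretely_lindelof X ->
  hausdorff_space X ->
  is_closed_pseudocharacter X kappa ->
  is_tightness X lambda ->
  [set: kappa * lambda] #= [set: nat] ->
  [set: X] #<= [set: continuum].
Proof.
move=> adL hX psiX tX; rewrite card_eq_le => /andP[kl _].
(* Both suprema are at least [nat], so each factor embeds in the product. *)
have /card_leTP[ik _ _] := psiX.1 nat (or_introl erefl).
have /card_leTP[il _ _] := tX.1 nat (or_introl erefl).
have kappa_nat : [set: kappa] #<= [set: nat].
  apply: card_le_trans kl; apply/card_leTP.
  by exists (fun k => (k, il 0)) => // k k' [].
have lambda_nat : [set: lambda] #<= [set: nat].
  apply: card_le_trans kl; apply/card_leTP.
  by exists (fun l => (ik 0, l)) => // l l' [].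
have tight := countable_tightness _ _ tX lambda_nat.
have [V [Vx Vcap]] :=
  countable_closed_pseudocharacter_family _ _ psiX hX kappa_nat.
have [[x0 _]|X0] := pselect ([set: X] !=set0); last first.
  suff -> : [set: X] = set0 by apply: card_ge0.
  by apply/seteqP; split=> // x _; apply: X0; exists x.
have [Y [covY Yclosed Yesc]] :=
  closing_off x0 V weak_power_continuum Vx Vcap tight.
rewrite -(closed_off_full V Y adL Vx Vcap covY Yclosed Yesc).
exact: covered_le.
Qed.
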